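(* Let $P(z)\in\mathbb{F}[z]^{m\times n}$ be a matrix polynomial of grade $k\ge 2$, let $v(z)=\omega^TV(z)$ be a scalar ansatz polynomial of grade $k-1$, where $\omega\in\mathbb{F}^k$ and $V(z)=[z^{k-1},\dots,z,1]^T$, and let $L(z)=\mathbb{DL}(P,v)\in\mathbb{F}[z]^{km\times kn}$. Suppose that the set of eigenvalues of $P(z)$ and the set of roots of $v(z)$, each including possibly infinite eigenvalues or roots, are disjoint. Let $N(z)$ be a (right) minimal basis of $L(z)$ and define the following matrices: 1. $\widehat M(z):=(\omega^T\otimes I_n)N(z)$; 2. partition, possibly after having permuted its columns, $\widehat M(z)=\begin{bmatrix}M_d(z)&M_c\end{bmatrix}$, where no column of $M_d(z)$ is constant in $z$ while $M_c$ is constant; 3. $\widetilde M(z):=M_d(z)$ if $M_c=0$, and otherwise $\widetilde M(z):=\begin{bmatrix}M_d(z)&M_b\end{bmatrix}$, where $M_b$ is (a matrix whose columns form) any basis of the column span of $M_c$ considered as a subspace over $\mathbb{F}$. Then $\widetilde M(z)$ is a (right) minimal basis of $P(z)$. Thus, $M_d(z)$ is a (right) minimal basis of $P(z)$ if and only if $M_c=0$.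
   Context: $\mathbb{F}$ is an algebraically closed field of characteristic $0$. A (matrix or scalar) polynomial of grade $g$ is a polynomial of degree at most $g$. An ansatz polynomial of grade $k-1$ is a nonzero scalar polynomial in $\mathbb{F}[z]$ of degree at most $k-1$. Pencil $\mathbb{DL}(P,v)$: with $V(x)=[x^{k-1},\dots,x,1]^T$, it is the unique $L(z)=zL_1+L_0\in\mathbb{F}[z]^{km\times kn}$ such that $$(V(y)^T\otimes I_m)\,L(z)\,(V(x)\otimes I_n)=\frac{P(y)(x-z)v(x)-P(x)(y-z)v(y)}{x-y}.$$ $\lambda\in\mathbb{F}$ is an eigenvalue of $P(z)$ if $\operatorname{rank}P(\lambda)<\operatorname{rank}P(z)$ (the latter rank over $\mathbb{F}(z)$); $\infty$ is an eigenvalue of $P(z)$ of grade $k$ if $0$ is an eigenvalue of $z^kP(z^{-1})$. $v$ of grade $k-1$ has a root at $\infty$ iff $\deg v<k-1$. $\ker P(z)=\{x(z)\in\mathbb{F}(z)^n:P(z)x(z)=0\}$. A (right) minimal basis of $P(z)$ is a matrix polynomial whose columns form a basis of $\ker P(z)$ over $\mathbb{F}(z)$ with minimal sum of column degrees among all polynomial bases of $\ker P(z)$. *)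

(* Defs.v *)
From HB Require Import structures.
From mathcomp Require Import all_boot all_order all_algebra all_fingroup.
From mathcomp.real_closed Require Import mxtens.

Set Implicit Arguments.
Unset Strict Implicit.
Unset Printing Implicit Defensive.

Import GRing.Theory.
Local Open Scope ring_scope.

Definition has_grade (F : fieldType) (m n g : nat) (A : 'M[{poly F}]_(m, n)) :=
  forall i j, (size (A i j) <= g.+1)%N.

(* [x^(k-1); ... ; x; 1] *)
Definition powers_vec (R : nzRingType) (k : nat) (x : R) : 'cV[R]_k :=
  \col_i x ^+ (k.-1 - i).

Definition ansatz (F : fieldType) (k : nat) (omega : 'cV[F]_k) : {poly F} :=
  ((map_mx polyC omega)^T *m powers_vec k 'X) 0 0.

(* u (x) I_p for a row vector u, and w (x) I_p for a column vector w; the casts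
   only replace the dimension 1 * p by p. *)
Definition row_kron (R : comNzRingType) (k : nat) (u : 'rV[R]_k) (p : nat) :
    'M[R]_(p, k * p) :=
  castmx (mul1n p, erefl (k * p)%N) (u *t (1%:M : 'M[R]_p)).

Definition col_kron (R : comNzRingType) (k : nat) (w : 'cV[R]_k) (p : nat) :
    'M[R]_(k * p, p) :=
  castmx (erefl (k * p)%N, mul1n p) (w *t (1%:M : 'M[R]_p)).

(* F[z][y][x], with its three indeterminates *)
Section Trivariate.
Variable F : fieldType.

Definition poly3 : idomainType := {poly {poly {poly F}}}.
Definition var_x : poly3 := 'X.
Definition var_y : poly3 := 'X%:P.
Definition var_z : poly3 := 'X%:P%:P.

Definition const3 (c : F) : poly3 := c%:P%:P%:P.

Definition subst3 (t : poly3) (p : {poly F}) : poly3 := (map_poly const3 p).[t].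

End Trivariate.

Arguments var_x {F}.
Arguments var_y {F}.
Arguments var_z {F}.

(* The divided difference defining DL(P, v) is an exact quotient in F[x, y, z],
   so the defining identity is written multiplied by x - y.  It determines the
   pencil L uniquely (compare the coefficients of y^i x^j). *)
Definition is_DL (F : fieldType) (m n k : nat) (P : 'M[{poly F}]_(m, n))
    (v : {poly F}) (L : 'M[{poly F}]_(k * m, k * n)) :=
  has_grade 1 L /\
  (var_x - var_y) *:
    (row_kron (powers_vec k var_y)^T m *m map_mx (subst3 var_z) L
       *m col_kron (powers_vec k var_x) n)
  = ((var_x - var_z) * subst3 var_x v) *: map_mx (subst3 var_y) P
    - ((var_y - var_z) * subst3 var_y v) *: map_mx (subst3 var_x) P.

Definition ratmx (F : fieldType) (m n : nat) (A : 'M[{poly F}]_(m, n)) :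
    'M[{fraction {poly F}}]_(m, n) :=
  map_mx (@tofrac {poly F}) A.

(* z^k A(1/z) *)
Definition reversal (F : fieldType) (m n k : nat) (A : 'M[{poly F}]_(m, n)) :
    'M[{poly F}]_(m, n) :=
  map_mx (fun p : {poly F} => \poly_(i < k.+1) p`_(k - i)) A.

Definition finite_eigenvalue (F : fieldType) (m n : nat)
    (A : 'M[{poly F}]_(m, n)) (a : F) : bool :=
  (\rank (map_mx (horner^~ a) A) < \rank (ratmx A))%N.

(* Points of the projective line over F: [Some a] is the finite point a and
   [None] is infinity. *)
Definition eigenvalue_of_grade (F : fieldType) (m n k : nat)
    (A : 'M[{poly F}]_(m, n)) (l : option F) : bool :=
  if l is Some a then finite_eigenvalue A a
  else finite_eigenvalue (reversal k A) 0.

(* A nonzero polynomial has degree < g exactly when its size is at most g. *)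
Definition root_of_grade (F : fieldType) (g : nat) (v : {poly F})
    (l : option F) : bool :=
  if l is Some a then root v a else (size v <= g)%N.

(* The columns of N form a basis over F(z) of the right kernel of A; [kermx] is
   a left kernel, whence the transpositions. *)
Definition kernel_basis (F : fieldType) (m n r : nat) (A : 'M[{poly F}]_(m, n))
    (N : 'M[{poly F}]_(n, r)) : bool :=
  row_free (ratmx N)^T && ((ratmx N)^T == kermx (ratmx A)^T)%MS.

Definition col_degree (F : fieldType) (n r : nat) (N : 'M[{poly F}]_(n, r))
    (j : 'I_r) : nat :=
  (\max_i size (N i j)).-1.

Definition minimal_basis (F : fieldType) (m n r : nat)
    (A : 'M[{poly F}]_(m, n)) (N : 'M[{poly F}]_(n, r)) : Prop :=
  kernel_basis A N /\
  forall (s : nat) (N' : 'M[{poly F}]_(n, s)), kernel_basis A N' ->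
    (\sum_j col_degree N j <= \sum_j col_degree N' j)%N.

Definition column_span_basis (F : fieldType) (n c b : nat)
    (M : 'M[F]_(n, c)) (B : 'M[F]_(n, b)) : bool :=
  row_free B^T && (B^T == M^T)%MS.

Definition no_constant_column (F : fieldType) (n d : nat)
    (M : 'M[{poly F}]_(n, d)) : Prop :=
  forall j, exists i, (1 < size (M i j))%N.

(* Main.v *)
(* Write L(z) = z L_1 + L_0, let v be the ansatz polynomial and
   W = omega^T (x) I_n.  Comparing coefficients of y in
   (V(z)^T (x) I) L(z) = omega^T (x) P(z), one sees that L w = 0 forces L_1 w to
   be the list of coefficients in y of the exact quotient
   P(y) u(z) / (y - z), where u = W w lies in ker P.  Two consequences:

   - the intersection of ker L and ker W is the kernel of the constant matrix
     G = [W; L_1], so it has a constant basis;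
   - every polynomial u in ker P lifts, without increase of degree, to a
     polynomial vector of ker L: the vector V(z) (x) u / v shows that u stacked
     on the coefficients of P(y) u(z) / (y - z) is in the range of G, and a
     constant pseudo-inverse of G produces the lift.

   Hence a basis of ker P can be completed to a basis of ker L with the same
   degree sum, so the degree sum of a minimal basis N of L is at most that of
   any basis of ker P.  As W N spans ker P, a dependency among the columns of
   [M_d M_b] would allow one to drop a nonconstant column and contradict this
   bound. *)

Require Import Defs.
From HB Require Import structures.
From mathcomp Require Import all_boot all_order all_algebra all_fingroup.
From mathcomp.real_closed Require Import mxtens.
From mathcomp Require Import zify.

Set Implicit Arguments.
Unset Strict Implicit.
Unset Printing Implicit Defensive.

Import GRing.Theory.
Local Open Scope ring_scope.

(** * Entries of products with Kronecker factors *)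

Lemma sum_mxtens_index (R : nmodType) (k p : nat) (G : 'I_(k * p) -> R) :
  \sum_i G i = \sum_a \sum_b G (mxtens_index (a, b)).
Proof.
rewrite (reindex (@mxtens_index k p)) /=; last first.
  by exists (@mxtens_unindex k p) => x _;
     rewrite ?mxtens_indexK ?mxtens_unindexK.
by rewrite pair_bigA; apply: eq_bigr => -[].
Qed.

Lemma mul_row_kron (R : comNzRingType) (k p q : nat) (u : 'rV[R]_k)
    (A : 'M[R]_(k * p, q)) (i : 'I_p) (j : 'I_q) :
  (row_kron u p *m A) i j = \sum_a u 0 a * A (mxtens_index (a, i)) j.
Proof.
rewrite mxE sum_mxtens_index.
have i0 : cast_ord (esym (mul1n p)) i = mxtens_index (ord0, i) :> 'I_(1 * p).
  exact/val_inj.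
apply: eq_bigr => a _; rewrite (bigD1 i) //= big1 ?addr0 => [|b neq_bi].
  by rewrite castmxE cast_ord_id i0 tensmxE mxE eqxx mulr1.
by rewrite castmxE cast_ord_id i0 tensmxE mxE eq_sym (negPf neq_bi) mulr0 mul0r.
Qed.

Lemma mul_col_kron (R : comNzRingType) (k p q : nat) (w : 'cV[R]_k)
    (A : 'M[R]_(q, k * p)) (i : 'I_q) (j : 'I_p) :
  (A *m col_kron w p) i j = \sum_a A i (mxtens_index (a, j)) * w a 0.
Proof.
rewrite mxE sum_mxtens_index.
have j0 : cast_ord (esym (mul1n p)) j = mxtens_index (ord0, j) :> 'I_(1 * p).
  exact/val_inj.
apply: eq_bigr => a _; rewrite (bigD1 j) //= big1 ?addr0 => [|b neq_bj].
  by rewrite castmxE cast_ord_id j0 tensmxE mxE eqxx mulr1.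
by rewrite castmxE cast_ord_id j0 tensmxE mxE (negPf neq_bj) !mulr0.
Qed.

Lemma col_kronE (R : comNzRingType) (k p : nat) (w : 'cV[R]_k)
    (a : 'I_k) (i j : 'I_p) :
  col_kron w p (mxtens_index (a, i)) j = w a 0 * (i == j)%:R.
Proof.
have j0 : cast_ord (esym (mul1n p)) j = mxtens_index (ord0, j) :> 'I_(1 * p).
  exact/val_inj.
by rewrite castmxE cast_ord_id j0 tensmxE mxE.
Qed.

Lemma row_kronE (R : comNzRingType) (k p : nat) (u : 'rV[R]_k)
    (a : 'I_k) (i j : 'I_p) :
  row_kron u p i (mxtens_index (a, j)) = u 0 a * (i == j)%:R.
Proof.
have i0 : cast_ord (esym (mul1n p)) i = mxtens_index (ord0, i) :> 'I_(1 * p).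
  exact/val_inj.
by rewrite castmxE cast_ord_id i0 tensmxE mxE.
Qed.

Lemma mul_row_col_kron (R : comNzRingType) (k p : nat) (u : 'rV[R]_k)
    (w : 'cV[R]_k) :
  row_kron u p *m col_kron w p = ((u *m w) 0 0)%:M.
Proof.
apply/matrixP => i j; rewrite mul_row_kron !mxE -sumrMnl.
by apply: eq_bigr => a _; rewrite col_kronE mulrA mulr_natr.
Qed.

Lemma map_row_kron (R S : comNzRingType) (f : {rmorphism R -> S}) (k p : nat)
    (u : 'rV[R]_k) :
  map_mx f (row_kron u p) = row_kron (map_mx f u) p.
Proof. by rewrite map_castmx map_mxT map_mx1. Qed.

(** * The two one-sided identities satisfied by the pencil *)

Lemma ansatzE (F : fieldType) (k : nat) (omega : 'cV[F]_k) :
  ansatz omega = \sum_a (omega a 0)%:P * 'X^(k.-1 - a).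
Proof. by rewrite /ansatz mxE; apply: eq_bigr => a _; rewrite !mxE. Qed.

Lemma map_subst3 (F : fieldType) (R : comNzRingType)
    (f : {rmorphism poly3 F -> R}) (t : poly3 F) (p : {poly F}) :
  f (subst3 t p) = (map_poly (f \o polyC \o polyC \o polyC) p).[f t].
Proof.
rewrite /subst3 -horner_map /= -map_poly_comp_id0 //.
by rewrite !rmorph0.
Qed.

Lemma coef_powers_sum (R : nzRingType) (k : nat) (c : 'I_k -> R) (b : 'I_k) :
  (\sum_a (c a)%:P * 'X^(k.-1 - a))`_(k.-1 - b) = c b.
Proof.
rewrite coef_sum (bigD1 b) //= coefCM coefXn eqxx mulr1 big1 ?addr0 // => a.
move=> neq_ab; rewrite coefCM coefXn; case: eqP => [eq_ab|]; last by rewrite mulr0.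
case/eqP: neq_ab; apply: val_inj => /=.
have := ltn_ord a; have := ltn_ord b; move: eq_ab.
by case: k a b {c} => // k a b /= eq_ab; rewrite !ltnS => lebk leak;
   rewrite -(subKn leak) -(subKn lebk) eq_ab.
Qed.

Lemma DL_entry (F : fieldType) (m n k : nat) (P : 'M[{poly F}]_(m, n))
    (v : {poly F}) (L : 'M[{poly F}]_(k * m, k * n)) :
  is_DL P v L -> forall (i : 'I_m) (j : 'I_n),
  (var_x - var_y) * (\sum_(b < k) (\sum_(a < k) var_y ^+ (k.-1 - a) *
      subst3 var_z (L (mxtens_index (a, i)) (mxtens_index (b, j)))) *
      var_x ^+ (k.-1 - b))
  = (var_x - var_z) * subst3 var_x v * subst3 var_y (P i j)
    - (var_y - var_z) * subst3 var_y v * subst3 var_x (P i j).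
Proof.
move=> [_ eqL] i j; have /matrixP/(_ i j) := eqL.
rewrite mxE mul_col_kron !mxE => <-; congr (_ * _).
apply: eq_bigr => b _; rewrite mul_row_kron !mxE; congr (_ * _).
by apply: eq_bigr => a _; rewrite !mxE.
Qed.
(** Setting y := z in the defining identity kills the term with factor y - z. The surviving factor x
    - z cancels, and the coefficients of the powers of x give the block columns. *)
Lemma DL_row_kron (F : fieldType) (m n k : nat) (P : 'M[{poly F}]_(m, n))
    (omega : 'cV[F]_k) (L : 'M[{poly F}]_(k * m, k * n)) :
  is_DL P (ansatz omega) L ->
  row_kron (powers_vec k 'X)^T m *m L
    = P *m row_kron (map_mx polyC omega)^T n.
Proof.
move=> /DL_entry entryL; apply/matrixP => i bj.
case: (mxtens_indexP bj) => b j; rewrite mul_row_kron mxE.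
under [RHS]eq_bigr do rewrite row_kronE.
rewrite [RHS](bigD1 j) //= [X in _ = _ + X]big1 => [|c /negPf->]; last first.
  by rewrite !mulr0.
rewrite eqxx mulr1 addr0 !mxE.
(* [phi] evaluates the middle variable y at z. In its target the outer indeterminate is still x, and
   y and z both become ['X%:P]. *)
pose phi : {rmorphism poly3 F -> {poly {poly F}}} :=
  map_poly (horner_eval ('X : {poly F})).
have phiC q : phi q%:P = (q.['X])%:P by rewrite /= map_polyC.
have phix : phi var_x = 'X by exact: map_polyX.
have phiy : phi var_y = 'X%:P by rewrite phiC hornerX.
have phiz : phi var_z = 'X%:P by rewrite phiC hornerC.
have phi_const p : map_poly (phi \o polyC \o polyC \o polyC) p
    = map_poly (polyC \o polyC) p.
  by apply: eq_map_poly => c /=; rewrite map_polyC /= /horner_eval hornerC.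
have substC t p : phi t = 'X%:P -> phi (subst3 t p) = p%:P.
  move=> phit; rewrite map_subst3 phi_const phit map_poly_comp /=.
  by rewrite horner_map /= -/(comp_poly _ _) comp_polyXr.
have := congr1 phi (entryL i j).
rewrite !(rmorphM, rmorphB) phix phiy phiz !(substC var_y) //.
rewrite subrr !mul0r subr0 -mulrA => /mulfI eq_phi.
have {eq_phi} := eq_phi (negbT (polyXsubC_eq0 _)).
rewrite map_subst3 phi_const phix map_poly_comp -/(_ \Po _) comp_polyXr.
rewrite ansatzE !rmorph_sum mulr_suml /=.
under eq_bigr => b' _.
  rewrite -/(phi _) rmorphM rmorphXn phix.
  have -> : phi (\sum_(a < k) var_y ^+ (k.-1 - a)
      * subst3 var_z (L (mxtens_index (a, i)) (mxtens_index (b', j))))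
    = (\sum_(a < k) 'X ^+ (k.-1 - a)
         * L (mxtens_index (a, i)) (mxtens_index (b', j)))%:P.
    rewrite !rmorph_sum; apply: eq_bigr => a _.
    by rewrite rmorphM rmorphXn phiy substC //= polyCM polyC_exp.
  over.
under [X in _ = X -> _]eq_bigr => b' _.
  rewrite rmorphM rmorphXn /= map_polyC map_polyX mulrAC -polyCM.
  over.
move=> /(congr1 (fun p : {poly {poly F}} => p`_(k.-1 - b))).
rewrite !coef_powers_sum mulrC => <-.
by apply: eq_bigr => a _; rewrite !mxE.
Qed.

(** The mirror argument: x := z kills the term with factor x - z, then z - y is cancelled, and the
    coefficients of the powers of y give the block rows. *)
Lemma DL_col_kron (F : fieldType) (m n k : nat) (P : 'M[{poly F}]_(m, n))
    (omega : 'cV[F]_k) (L : 'M[{poly F}]_(k * m, k * n)) :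
  is_DL P (ansatz omega) L ->
  L *m col_kron (powers_vec k 'X) n = col_kron (map_mx polyC omega) m *m P.
Proof.
move=> /DL_entry entryL; apply/matrixP => ai j.
case: (mxtens_indexP ai) => a i; rewrite mul_col_kron mxE.
under [RHS]eq_bigr do rewrite col_kronE.
rewrite [RHS](bigD1 i) //= [X in _ = _ + X]big1 => [|c neq_ci]; last first.
  by rewrite eq_sym (negPf neq_ci) mulr0 mul0r.
rewrite eqxx mulr1 addr0 !mxE.
(* Here the outermost variable x is evaluated at z, so in the target ['X] stands for y. *)
pose phi : {rmorphism poly3 F -> {poly {poly F}}} :=
  horner_eval ('X%:P : {poly {poly F}}).
have phiC q : phi q%:P = q by rewrite /= /horner_eval hornerC.
have phix : phi var_x = 'X%:P by rewrite /= /horner_eval hornerX.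
have phiy : phi var_y = 'X by rewrite phiC.
have phiz : phi var_z = 'X%:P by rewrite phiC.
have phi_const p : map_poly (phi \o polyC \o polyC \o polyC) p
    = map_poly (polyC \o polyC) p.
  by apply: eq_map_poly => c /=; rewrite /horner_eval hornerC.
have substC t p : phi t = 'X%:P -> phi (subst3 t p) = p%:P.
  move=> phit; rewrite map_subst3 phi_const phit map_poly_comp /=.
  by rewrite horner_map /= -/(comp_poly _ _) comp_polyXr.
have := congr1 phi (entryL i j).
rewrite !(rmorphM, rmorphB) phix phiy phiz !(substC var_x) //.
rewrite subrr !mul0r sub0r -mulrA -mulNr opprB => /mulfI eq_phi.
have {eq_phi} := eq_phi _.
rewrite -opprB oppr_eq0 => /(_ (negbT (polyXsubC_eq0 _))).
rewrite map_subst3 phi_const phiy map_poly_comp -/(_ \Po _) comp_polyXr.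
rewrite ansatzE !rmorph_sum mulr_suml /=.
under eq_bigr => b _.
  rewrite -/(phi _) rmorphM rmorphXn phix rmorph_sum mulr_suml.
  over.
rewrite exchange_big /=.
under eq_bigr => a' _.
  under eq_bigr => b _.
    rewrite -/(phi _) rmorphM rmorphXn phiy substC // mulrC mulrA mulrAC.
    rewrite -polyC_exp -polyCM.
    over.
  rewrite -mulr_suml -rmorph_sum /=.
  over.
under [X in _ = X -> _]eq_bigr => b' _.
  rewrite rmorphM rmorphXn /= map_polyC map_polyX mulrAC -polyCM.
  over.
move=> /(congr1 (fun p : {poly {poly F}} => p`_(k.-1 - a))).
rewrite !coef_powers_sum => <-.
by apply: eq_bigr => b _; rewrite !mxE mulrC.
Qed.

(** * Row blocks and coefficients of the pencil *)

(** The index is a natural number and blocks from k on are zero. This makes the recurrences between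
    blocks a and a+1 uniform up to a = k-1, and the vanishing of block k later expresses that a
    division is exact. *)
Definition row_block (R : nmodType) (k p q : nat) (A : 'M[R]_(k * p, q))
    (a : nat) : 'M[R]_(p, q) :=
  if insub a is Some a' then \matrix_(i, j) A (mxtens_index (a', i)) j else 0.

Lemma row_blockE (R : nmodType) (k p q : nat) (A : 'M[R]_(k * p, q))
    (a : 'I_k) i j :
  row_block A a i j = A (mxtens_index (a, i)) j.
Proof. by rewrite /row_block valK mxE. Qed.

Lemma row_block_out (R : nmodType) (k p q a : nat) (A : 'M[R]_(k * p, q)) :
  (k <= a)%N -> row_block A a = 0.
Proof. by move=> leka; rewrite /row_block insubF // ltnNge leka. Qed.

Lemma row_blockP (R : nmodType) (k p q : nat) (A B : 'M[R]_(k * p, q)) :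
  (forall a, (a < k)%N -> row_block A a = row_block B a) -> A = B.
Proof.
move=> eqAB; apply/matrixP => ai j; case: (mxtens_indexP ai) => a i.
by rewrite -!row_blockE eqAB.
Qed.

Lemma row_block0 (R : nmodType) (k p q a : nat) :
  row_block (0 : 'M[R]_(k * p, q)) a = 0.
Proof.
rewrite /row_block; case: insubP => // a' _ _.
by apply/matrixP => i j; rewrite !mxE.
Qed.

Lemma row_block_mul (R : pzSemiRingType) (k p q r a : nat)
    (A : 'M[R]_(k * p, q)) (B : 'M[R]_(q, r)) :
  row_block (A *m B) a = row_block A a *m B.
Proof.
rewrite /row_block; case: insubP => [a' _ _|_]; last by rewrite mul0mx.
by apply/matrixP => i j; rewrite !mxE; apply: eq_bigr => l _; rewrite mxE.
Qed.

Lemma row_block_map (R S : pzSemiRingType) (f : {rmorphism R -> S})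
    (k p q a : nat) (A : 'M[R]_(k * p, q)) :
  row_block (map_mx f A) a = map_mx f (row_block A a).
Proof.
rewrite /row_block; case: insubP => [a' _ _|_]; last by rewrite map_mx0.
by apply/matrixP => i j; rewrite !mxE.
Qed.

Lemma row_blockZD (R : pzSemiRingType) (k p q a : nat) (c : R)
    (A B : 'M[R]_(k * p, q)) :
  row_block (A + c *: B) a = row_block A a + c *: row_block B a.
Proof.
rewrite /row_block; case: insubP => [a' _ _|_]; last by rewrite scaler0 addr0.
by apply/matrixP => i j; rewrite !mxE.
Qed.

Definition coef_mx (R : nzSemiRingType) (m n e : nat) (A : 'M[{poly R}]_(m, n)) :=
  map_mx (coefp e) A.

Lemma coef_row_block (R : nzSemiRingType) (k p q e a : nat)
    (A : 'M[{poly R}]_(k * p, q)) i j :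
  row_block (coef_mx e A) a i j = (row_block A a i j)`_e.
Proof.
rewrite /row_block; case: insubP => [a' _ _|_]; rewrite !mxE //.
by rewrite coef0.
Qed.

Lemma grade1_expand (F : fieldType) (m n : nat) (L : 'M[{poly F}]_(m, n)) :
  has_grade 1 L ->
  L = map_mx polyC (coef_mx 0 L) + 'X *: map_mx polyC (coef_mx 1 L).
Proof.
move=> gradeL; apply/matrixP => i j; rewrite !mxE /=; apply/polyP => e.
rewrite coefD coefXM !coefC; case: e => [|[|e]] /=; rewrite ?addr0 ?add0r //.
by rewrite nth_default // (leq_trans (gradeL i j)).
Qed.

(** As [p a] has degree at most 1, its summand only reaches the exponents k-1-a and k-a. Exponent
    k-1-b therefore meets just a = b and a = b+1, and exponent k just a = 0. The vanishing of [p]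
    from k on covers b = k-1. *)
Lemma coef_pencil_sum (R : nzRingType) (k : nat) (p : nat -> {poly R}) :
  (forall a, (size (p a) <= 2)%N) -> (forall a, (k <= a)%N -> p a = 0) ->
  let q := \sum_(a < k) 'X^(k.-1 - a) * p a in
  q`_k = (p 0)`_1 /\
  forall b, (b < k)%N -> q`_(k.-1 - b) = (p b)`_0 + (p b.+1)`_1.
Proof.
case: k => [|k] size_p p_out /=.
  by rewrite p_out // big_ord0 !coef0.
have p_coef a e : (1 < e)%N -> (p a)`_e = 0.
  by move=> lt1e; rewrite nth_default // (leq_trans (size_p a)).
rewrite !coef_sum; split=> [|b]; last first.
  rewrite ltnS => lebk.
  (* Both contributions are spread over the index range so that the two sums can be compared term by
     term. *)
  have -> : (p b)`_0 + (p b.+1)`_1 = \sum_(a < k.+1)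
      ((if a == b :> nat then (p a)`_0 else 0)
        + (if a == b.+1 :> nat then (p a)`_1 else 0)).
    rewrite big_split /= -!big_mkcond /=; congr (_ + _).
      by rewrite (big_pred1 (Ordinal (lebk : b < k.+1)%N)).
    have [ltbk|lekb] := ltnP b k.
      by rewrite (big_pred1 (Ordinal (ltbk : b.+1 < k.+1)%N)).
    rewrite p_out // coef0 big_pred0 // => a; apply/negbTE.
    by rewrite neq_ltn (leq_trans (ltn_ord a)) // ltnS.
  rewrite coef_sum; apply: eq_bigr => a _; have := ltn_ord a; rewrite ltnS => leak.
  rewrite coefXnM; have [ltab|ltba|<-] := ltngtP (a : nat) b.
  - by rewrite ifT ?ltn_eqF ?addr0 //; lia.
  - rewrite ifF; last lia.
    have -> : (k - b - (k - a) = a - b)%N by lia.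
    have [->|neq_ab] := eqVneq (a : nat) b.+1; first by rewrite subSnn add0r.
    by rewrite p_coef ?addr0 //; lia.
  - by rewrite ltnn subnn ltn_eqF ?addr0.
rewrite big_ord_recl coefXnM ifF /= ?subn0 ?subSnn; last lia.
rewrite big1 ?addr0 // => a _; have := ltn_ord a; rewrite coefXnM /bump /=.
by move=> ltak; rewrite ifF ?p_coef //; lia.
Qed.

(** These are the coefficients of the powers of z in [DL_row_kron]. They tie each block of L_0 to
    the next block of L_1, which is the recurrence of synthetic division. *)
Lemma DL_coef (F : fieldType) (m n k : nat) (P : 'M[{poly F}]_(m, n))
    (omega : 'cV[F]_k) (L : 'M[{poly F}]_(k * m, k * n)) :
  is_DL P (ansatz omega) L ->
  row_block (coef_mx 1 L) 0 = coef_mx k P *m row_kron omega^T n /\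
  forall a, (a < k)%N ->
    row_block (coef_mx 0 L) a + row_block (coef_mx 1 L) a.+1
      = coef_mx (k.-1 - a) P *m row_kron omega^T n.
Proof.
move=> DL; have rowL := DL_row_kron DL; have [gradeL _] := DL.
have coefPW e : coef_mx e (row_kron (powers_vec k 'X)^T m *m L)
    = coef_mx e P *m row_kron omega^T n.
  rewrite rowL map_trmx -map_row_kron; apply/matrixP => i j; rewrite !mxE /=.
  by rewrite coef_sum; apply: eq_bigr => l _; rewrite !mxE coefMC.
have entryL i j :
    (row_kron (powers_vec k 'X)^T m *m L) i j
      = \sum_(a < k) 'X^(k.-1 - a) * row_block L a i j.
  by rewrite mul_row_kron; apply: eq_bigr => a _; rewrite row_blockE !mxE.
have pencil i j : let q := \sum_(a < k) 'X^(k.-1 - a) * row_block L a i j in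
    q`_k = (row_block L 0 i j)`_1 /\
    forall b, (b < k)%N ->
      q`_(k.-1 - b) = (row_block L b i j)`_0 + (row_block L b.+1 i j)`_1.
  apply: (coef_pencil_sum (p := fun a => row_block L a i j)) => a; last first.
    by move=> /row_block_out->; rewrite mxE.
  rewrite /row_block; case: insubP => [a' _ _|_]; rewrite mxE ?size_poly0 ?gradeL //.
split=> [|a ltak]; rewrite -coefPW; apply/matrixP => i j.
  by rewrite coef_row_block -(pencil i j).1 -entryL !mxE.
by rewrite mxE !coef_row_block -(pencil i j).2 // -entryL [RHS]mxE.
Qed.

(** * Matrices over F(z), and the quotient of P(y) u(z) by y - z *)

Lemma ratmxM (F : fieldType) (m n p : nat) (A : 'M[{poly F}]_(m, n))
    (B : 'M[{poly F}]_(n, p)) :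
  ratmx (A *m B) = ratmx A *m ratmx B.
Proof. exact: map_mxM. Qed.

Lemma ratmx0 (F : fieldType) (m n : nat) : ratmx (0 : 'M[{poly F}]_(m, n)) = 0.
Proof. exact: map_mx0. Qed.

Lemma ratmxD (F : fieldType) (m n : nat) (A B : 'M[{poly F}]_(m, n)) :
  ratmx (A + B) = ratmx A + ratmx B.
Proof. exact: map_mxD. Qed.

Lemma ratmxZ (F : fieldType) (m n : nat) (c : {poly F})
    (A : 'M[{poly F}]_(m, n)) :
  ratmx (c *: A) = tofrac c *: ratmx A.
Proof. exact: map_mxZ. Qed.

Lemma ratmx_row (F : fieldType) (m n p : nat) (A : 'M[{poly F}]_(m, n))
    (B : 'M[{poly F}]_(m, p)) :
  ratmx (row_mx A B) = row_mx (ratmx A) (ratmx B).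
Proof. exact: map_row_mx. Qed.

Lemma ratmx_inj (F : fieldType) (m n : nat) : injective (@ratmx F m n).
Proof.
move=> A B /matrixP eqAB; apply/matrixP => i j.
by have := eqAB i j; rewrite !mxE => /eqP; rewrite tofrac_eq => /eqP.
Qed.

Lemma ratmx_const (F : fieldType) (m n : nat) (A : 'M[F]_(m, n)) :
  ratmx (map_mx polyC A) = map_mx (@tofrac {poly F} \o polyC) A.
Proof. by rewrite map_mx_comp. Qed.

(* The coefficients (in y) of P(y) u(z) / (y - z), by synthetic division. *)
Fixpoint quotient_row (F : fieldType) (m n k s : nat) (P : 'M[{poly F}]_(m, n))
    (u : 'M[{poly F}]_(n, s)) (a : nat) : 'M[{poly F}]_(m, s) :=
  if a is b.+1 then
    map_mx polyC (coef_mx (k.-1 - b) P) *m u + 'X *: quotient_row k P u b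
  else map_mx polyC (coef_mx k P) *m u.

Lemma quotient_row0 (F : fieldType) (m n k s : nat) (P : 'M[{poly F}]_(m, n))
    (a : nat) :
  quotient_row k P (0 : 'M_(n, s)) a = 0.
Proof. by elim: a => [|a IHa] /=; rewrite mulmx0 // IHa scaler0 addr0. Qed.

Lemma size_sum_const_mul (F : fieldType) (I : finType) (c : I -> F)
    (p : I -> {poly F}) (N : nat) :
  (forall i, size (p i) <= N)%N -> (size (\sum_i (c i)%:P * p i)%R <= N)%N.
Proof.
move=> size_p; apply: (leq_trans (size_sum _ _ _)); apply/bigmax_leqP => i _.
by rewrite mul_polyC (leq_trans (size_scale_leq _ _)).
Qed.

(** Read upwards, the recurrence could raise the degree at each step. Since the remainder
    [quotient_row k P u k] is zero, it can be read downwards from k instead: z times row b is row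
    b+1 minus a constant combination of the entries of u, so the bound N persists. *)
Lemma size_quotient_row (F : fieldType) (m n k s : nat)
    (P : 'M[{poly F}]_(m, n)) (u : 'M[{poly F}]_(n, s)) (j : 'I_s) (N : nat) :
  quotient_row k P u k = 0 -> (forall i, size (u i j) <= N)%N ->
  forall a i, (a <= k)%N -> (size (quotient_row k P u a i j) <= N)%N.
Proof.
move=> exact_div size_u a i leak; rewrite -(subKn leak).
elim: (k - a)%N (leq_subr a k) => [|e IHe] leek.
  by rewrite subn0 exact_div mxE size_poly0.
have := IHe (ltnW leek).
have -> : (k - e = (k - e.+1).+1)%N by lia.
set b := (k - e.+1)%N; rewrite [quotient_row _ _ _ b.+1]/= mxE => size_S.
(* The recurrence solved for z times row b. *)
have : (size ('X * quotient_row k P u b i j)%R <= N)%N.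
  rewrite -[X in polyseq X](addrK ((map_mx polyC (coef_mx (k.-1 - b) P) *m u) i j)).
  rewrite (leq_trans (size_polyD _ _)) // geq_max size_polyN addrC.
  move: size_S; rewrite [X in polyseq (_ + X)]mxE => -> /=; rewrite mxE.
  under eq_bigr do rewrite mxE.
  exact: size_sum_const_mul.
have [->|nz] := eqVneq (quotient_row k P u b i j) 0; first by rewrite size_poly0.
by rewrite mulrC size_mulX //; exact: ltnW.
Qed.

(** From L w = 0, block a of L_0 w is -z times block a of L_1 w. Substituted in [DL_coef], this says
    that the blocks of L_1 w obey the recurrence of [quotient_row]. Here w may be rational, as is
    the lift V(z) (x) u / v, while u is polynomial. *)
Lemma DL_kernel_blocks (F : fieldType) (m n k s : nat)
    (P : 'M[{poly F}]_(m, n)) (omega : 'cV[F]_k)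
    (L : 'M[{poly F}]_(k * m, k * n)) (w : 'M[{fraction {poly F}}]_(k * n, s))
    (u : 'M[{poly F}]_(n, s)) :
  is_DL P (ansatz omega) L -> ratmx L *m w = 0 ->
  ratmx (map_mx polyC (row_kron omega^T n)) *m w = ratmx u ->
  forall a, (a <= k)%N ->
    row_block (ratmx (map_mx polyC (coef_mx 1 L)) *m w) a
      = ratmx (quotient_row k P u a).
Proof.
move=> DL; have [lead rest] := DL_coef DL; have [gradeL _] := DL.
set W := row_kron _ _ in lead rest *.
move=> Lw0 Ww a.
have blockL (A : 'M[F]_(k * m, k * n)) b :
    row_block (ratmx (map_mx polyC A) *m w) b
      = ratmx (map_mx polyC (row_block A b)) *m w.
  by rewrite row_block_mul /ratmx !row_block_map.
elim: a => [|a IHa] leak; rewrite blockL.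
  by rewrite lead map_mxM ratmxM -mulmxA Ww -ratmxM.
have := congr1 (@row_block _ k m s ^~ a) Lw0.
rewrite [in L in ratmx L](grade1_expand gradeL) ratmxD ratmxZ mulmxDl -scalemxAl.
rewrite row_blockZD (IHa (ltnW leak)) row_block0 blockL => /eqP.
rewrite addr_eq0 => /eqP L0w.
have -> : row_block (coef_mx 1 L) a.+1
    = coef_mx (k.-1 - a) P *m W - row_block (coef_mx 0 L) a.
  by rewrite -rest // addrC addKr.
rewrite map_mxB /ratmx map_mxB mulmxBl -/(ratmx _) -/(ratmx _) L0w opprK /=.
by rewrite map_mxM ratmxM -mulmxA Ww -/(ratmx _) ratmxD ratmxM ratmxZ.
Qed.

(** The same recurrence read backwards. The case a = k of the assumption, where the block is zero,
    says that the remainder vanishes; it yields the last block of L w. *)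
Lemma DL_kernel_of_blocks (F : fieldType) (m n k s : nat)
    (P : 'M[{poly F}]_(m, n)) (omega : 'cV[F]_k)
    (L : 'M[{poly F}]_(k * m, k * n)) (w : 'M[{poly F}]_(k * n, s)) :
  is_DL P (ansatz omega) L ->
  let u := map_mx polyC (row_kron omega^T n) *m w in
  (forall a, (a <= k)%N ->
    row_block (map_mx polyC (coef_mx 1 L) *m w) a = quotient_row k P u a) ->
  L *m w = 0.
Proof.
move=> DL u blocks; have [_ rest] := DL_coef DL; have [gradeL _] := DL.
have blockL (A : 'M[F]_(k * m, k * n)) b :
    row_block (map_mx polyC A *m w) b = map_mx polyC (row_block A b) *m w.
  by rewrite row_block_mul row_block_map.
apply: row_blockP => a ltak.
rewrite [in LHS](grade1_expand gradeL) mulmxDl -scalemxAl row_blockZD row_block0.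
rewrite (blocks _ (ltnW ltak)) blockL.
have -> : row_block (coef_mx 0 L) a
    = coef_mx (k.-1 - a) P *m row_kron omega^T n - row_block (coef_mx 1 L) a.+1.
  by rewrite -rest // addrK.
rewrite map_mxB mulmxBl -blockL (blocks _ ltak) map_mxM -mulmxA -/u /=.
by rewrite opprD addNKr addNr.
Qed.

(** * Column degrees *)

Lemma leq_col_degree (F : fieldType) (n p r s : nat) (A : 'M[{poly F}]_(n, r))
    (B : 'M[{poly F}]_(p, s)) (j : 'I_r) (l : 'I_s) :
  (forall i, (size (A i j) <= \max_i size (B i l))%N) ->
  (col_degree A j <= col_degree B l)%N.
Proof.
move=> le_size; rewrite /col_degree -!subn1 leq_sub2r //.
exact/bigmax_leqP.
Qed.

Lemma col_degree_const_mul (F : fieldType) (m n r : nat) (A : 'M[F]_(m, n))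
    (B : 'M[{poly F}]_(n, r)) (j : 'I_r) :
  (col_degree (map_mx polyC A *m B) j <= col_degree B j)%N.
Proof.
apply: leq_col_degree => i; rewrite mxE.
under [X in polyseq X]eq_bigr do rewrite mxE.
apply: size_sum_const_mul => l.
exact: (leq_bigmax (F := fun l => size (B l j))).
Qed.

Lemma col_degree_const (F : fieldType) (n r : nat) (A : 'M[F]_(n, r)) j :
  col_degree (map_mx polyC A) j = 0%N.
Proof.
apply/eqP; rewrite /col_degree -subn1 subn_eq0; apply/bigmax_leqP => i _.
by rewrite mxE size_polyC leq_b1.
Qed.

Lemma col_degree_row_mxEl (F : fieldType) (n r s : nat)
    (A : 'M[{poly F}]_(n, r)) (B : 'M[{poly F}]_(n, s)) j :
  col_degree (row_mx A B) (lshift s j) = col_degree A j.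
Proof. by congr _.-1; apply: eq_bigr => i _; rewrite row_mxEl. Qed.

Lemma col_degree_row_mxEr (F : fieldType) (n r s : nat)
    (A : 'M[{poly F}]_(n, r)) (B : 'M[{poly F}]_(n, s)) j :
  col_degree (row_mx A B) (rshift r j) = col_degree B j.
Proof. by congr _.-1; apply: eq_bigr => i _; rewrite row_mxEr. Qed.

(** * Lifting ker P to ker L *)

Lemma DL_lift (F : fieldType) (m n k s : nat) (P : 'M[{poly F}]_(m, n))
    (omega : 'cV[F]_k) (L : 'M[{poly F}]_(k * m, k * n))
    (Q : 'M[{poly F}]_(n, s)) :
  ansatz omega != 0 -> is_DL P (ansatz omega) L -> P *m Q = 0 ->
  exists w : 'M[{poly F}]_(k * n, s),
    [/\ L *m w = 0, map_mx polyC (row_kron omega^T n) *m w = Q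
      & forall j, (col_degree w j <= col_degree Q j)%N].
Proof.
move=> v_neq0 DL PQ0; set W := row_kron omega^T n; set L1 := coef_mx 1 L.
pose VQ := col_kron (powers_vec k 'X) n *m Q.
(* The rational lift V(z) (x) Q / v: it lies in ker L by [DL_col_kron], and W maps it to Q because
   omega^T V(z) = v. *)
pose w0 := (tofrac (ansatz omega))^-1 *: ratmx VQ.
have Lw0 : ratmx L *m w0 = 0.
  rewrite -scalemxAr -ratmxM mulmxA (DL_col_kron DL) -mulmxA PQ0 mulmx0.
  by rewrite ratmx0 scaler0.
have Ww0 : ratmx (map_mx polyC W) *m w0 = ratmx Q.
  rewrite -scalemxAr -ratmxM mulmxA map_row_kron -map_trmx mul_row_col_kron.
  rewrite -/(ansatz omega) mul_scalar_mx ratmxZ scalerA mulVf ?scale1r //.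
  by rewrite tofrac_eq0.
have blocks := DL_kernel_blocks DL Lw0 Ww0.
(* Block k is zero by the convention of [row_block], so the remainder is zero. *)
have exact_div : quotient_row k P Q k = 0.
  by apply: ratmx_inj; rewrite -blocks // row_block_out // ratmx0.
pose tau : 'M_(k * m, s) := \matrix_(i, j)
  quotient_row k P Q (mxtens_unindex i).1 (mxtens_unindex i).2 j.
have tauE a : (a <= k)%N -> row_block tau a = quotient_row k P Q a.
  rewrite leq_eqVlt => /orP[/eqP->|ltak]; first by rewrite row_block_out.
  apply/matrixP => i j.
  by rewrite (row_blockE _ (Ordinal ltak)) mxE mxtens_indexK.
pose G := col_mx W L1; pose t := col_mx Q tau.
have Gw0 : ratmx (map_mx polyC G) *m w0 = ratmx t.
  rewrite /ratmx !map_col_mx mul_col_mx -!/(ratmx _) Ww0; congr col_mx.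
  by apply: row_blockP => a /ltnW leak; rewrite blocks // /ratmx row_block_map tauE.
(* [w0] shows that t lies in the range of G over F(z). The pseudo-inverse of the constant matrix G
   is constant and remains a pseudo-inverse over F(z), so [w] is a polynomial preimage of t. *)
pose w := map_mx polyC (pinvmx G^T)^T *m t.
have Gw : map_mx polyC G *m w = t.
  have sub_tG : ((ratmx t)^T
      <= map_mx (@tofrac {poly F} \o polyC) G^T)%MS.
    by rewrite -Gw0 trmx_mul ratmx_const map_trmx submxMl.
  apply/ratmx_inj/trmx_inj; rewrite -[RHS](mulmxKpV sub_tG) -map_pinvmx.
  by rewrite 2!ratmxM 2!trmx_mul !ratmx_const !map_trmx trmxK.
have /eq_col_mx[Ww L1w] : col_mx (map_mx polyC W *m w) (map_mx polyC L1 *m w) = t.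
  by rewrite -mul_col_mx -map_col_mx.
exists w; split=> // [|j].
  by apply: (DL_kernel_of_blocks DL) => a leak; rewrite L1w Ww tauE.
(* A constant factor does not raise degrees, and the rows of t are rows of Q or quotient rows, which
   [size_quotient_row] bounds. *)
apply: leq_trans (col_degree_const_mul _ _ _) _; apply: leq_col_degree => i.
have size_Q l : (size (Q l j) <= \max_i size (Q i j))%N.
  exact: (leq_bigmax (F := fun l => size (Q l j))).
rewrite mxE; case: splitP => // l _; rewrite mxE.
exact: size_quotient_row _ exact_div size_Q _ _ (ltnW (ltn_ord _)).
Qed.

(** The basis is [w Z], where w lifts Q and Z is a constant basis of ker G, the intersection of ker
    L and ker W. The columns of Z have degree 0, so they leave the degree sum unchanged. *)
Lemma kernel_basis_lift (F : fieldType) (m n k s : nat)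
    (P : 'M[{poly F}]_(m, n)) (omega : 'cV[F]_k)
    (L : 'M[{poly F}]_(k * m, k * n)) (Q : 'M[{poly F}]_(n, s)) :
  ansatz omega != 0 -> is_DL P (ansatz omega) L -> kernel_basis P Q ->
  exists r (N : 'M[{poly F}]_(k * n, r)), kernel_basis L N /\
    (\sum_j col_degree N j <= \sum_j col_degree Q j)%N.
Proof.
move=> v_neq0 DL /andP[freeQ /eqmxP spanQ].
have PQ0 : P *m Q = 0.
  apply/ratmx_inj/trmx_inj; rewrite ratmxM ratmx0 trmx_mul trmx0.
  by apply/sub_kermxP; rewrite spanQ.
have [w [Lw Ww deg_w]] := DL_lift v_neq0 DL PQ0.
set W := row_kron omega^T n in Ww; set L1 := coef_mx 1 L.
pose G := col_mx W L1; pose Z := (row_base (kermx G^T))^T.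
have GZ : G *m Z = 0.
  apply: trmx_inj; rewrite trmx_mul trmxK trmx0.
  by apply/sub_kermxP; rewrite eq_row_base.
have /eq_col_mx[WZ L1Z] : col_mx (W *m Z) (L1 *m Z) = col_mx 0 0.
  by rewrite -mul_col_mx GZ col_mx0.
have LZ : L *m map_mx polyC Z = 0.
  apply: (DL_kernel_of_blocks DL) => a _.
  by rewrite -!map_mxM L1Z WZ !map_mx0 row_block0 quotient_row0.
exists _, (row_mx w (map_mx polyC Z)); split; last first.
  rewrite big_split_ord /= [X in (_ + X)%N]big1 ?addn0 => [|j _].
    by apply: leq_sum => j _; rewrite col_degree_row_mxEl.
  by rewrite col_degree_row_mxEr col_degree_const.
have WwT : (ratmx w)^T *m (ratmx (map_mx polyC W))^T = (ratmx Q)^T.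
  by rewrite -trmx_mul -ratmxM Ww.
have WZT : (ratmx (map_mx polyC Z))^T *m (ratmx (map_mx polyC W))^T = 0.
  by rewrite -trmx_mul -ratmxM -map_mxM WZ map_mx0 ratmx0 trmx0.
have ZT : (ratmx (map_mx polyC Z))^T
    = map_mx (@tofrac {poly F} \o polyC) (row_base (kermx G^T)).
  by rewrite ratmx_const map_trmx trmxK.
rewrite /kernel_basis ratmx_row tr_row_mx.
apply/andP; split.
  (* Independence: W kills Z and maps w to the independent columns of Q, so the coefficients of w
     vanish; then those of Z do. *)
  apply/inj_row_free => c; rewrite -[c]hsubmxK mul_row_col => cwZ.
  have c1_0 : lsubmx c = 0.
    apply: (row_free_inj freeQ); rewrite mul0mx -WwT mulmxA.
    move: (congr1 (mulmx^~ (ratmx (map_mx polyC W))^T) cwZ).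
    by rewrite mulmxDl mul0mx -[X in _ + X]mulmxA WZT mulmx0 addr0.
  move: cwZ; rewrite c1_0 mul0mx add0r ZT => c2Z.
  rewrite (_ : rsubmx c = 0) ?row_mx0 //.
  apply: (row_free_inj
    (A := map_mx (@tofrac {poly F} \o polyC) (row_base (kermx G^T)))).
    by rewrite row_free_map row_base_free.
  by rewrite mul0mx.
apply/andP; split.
  apply/sub_kermxP; rewrite mul_col_mx -!trmx_mul -!ratmxM Lw LZ.
  by rewrite !ratmx0 !trmx0 col_mx0.
set X := kermx (ratmx L)^T.
have XL : X *m (ratmx L)^T = 0 by exact: mulmx_ker.
have /submxP[C eqC] : (X *m (ratmx (map_mx polyC W))^T <= (ratmx Q)^T)%MS.
  rewrite spanQ; apply/sub_kermxP; rewrite -mulmxA -trmx_mul -ratmxM.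
  rewrite [map_mx polyC W]map_row_kron -map_trmx -(DL_row_kron DL) ratmxM trmx_mul.
  by rewrite mulmxA XL mul0mx.
(* Spanning: W maps ker L into ker P, the span of Q. Subtracting the matching combination of w
   leaves [Y] in ker L and ker W; by [DL_kernel_blocks] with u = 0 it is also killed by L_1, hence
   lies in ker G. *)
pose Y := X - C *m (ratmx w)^T.
have YL : Y *m (ratmx L)^T = 0.
  by rewrite mulmxBl XL -mulmxA -trmx_mul -ratmxM Lw ratmx0 trmx0 mulmx0 subr0.
have YW : Y *m (ratmx (map_mx polyC W))^T = 0.
  by rewrite mulmxBl eqC -mulmxA WwT subrr.
have L1Y : ratmx (map_mx polyC L1) *m Y^T = 0.
  have LY : ratmx L *m Y^T = 0 by apply: trmx_inj; rewrite trmx_mul trmxK trmx0.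
  have WY : ratmx (map_mx polyC W) *m Y^T = ratmx 0.
    by apply: trmx_inj; rewrite trmx_mul trmxK ratmx0 trmx0.
  apply: row_blockP => a /ltnW leak.
  by rewrite (DL_kernel_blocks DL LY WY) // quotient_row0 ratmx0 row_block0.
have sYZ : (Y <= (ratmx (map_mx polyC Z))^T)%MS.
  (* The kernel of a constant matrix has the same basis over F and over F(z). *)
  have sub_base : (map_mx (@tofrac {poly F} \o polyC) (kermx G^T)
      <= map_mx (@tofrac {poly F} \o polyC) (row_base (kermx G^T)))%MS.
    by rewrite map_submx eq_row_base.
  rewrite ZT (submx_trans _ sub_base) // map_kermx; apply/sub_kermxP.
  apply: trmx_inj; rewrite trmx_mul map_trmx trmxK trmx0 -ratmx_const.
  rewrite [map_mx polyC G]map_col_mx /ratmx map_col_mx mul_col_mx -!/(ratmx _) L1Y.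
  rewrite -[ratmx (map_mx polyC W)]trmxK -trmx_mul YW trmx0.
  exact: col_mx0.
rewrite -[X](subrK (C *m (ratmx w)^T)) addrC.
apply: submx_trans (addmx_sub_adds (submxMl C _) sYZ) _.
by rewrite addsmxE.
Qed.

(** * Extracting bases from spanning families *)

(** The dependency c expresses column j through the others. Column j is replaced by zero rather than
    deleted, so a maximal free subfamily is still indexed by columns of M. *)
Lemma kernel_basis_of_spanning (F : fieldType) (m n r : nat)
    (A : 'M[{poly F}]_(m, n)) (M : 'M[{poly F}]_(n, r)) (j : 'I_r)
    (c : 'rV[{fraction {poly F}}]_r) :
  ((ratmx M)^T == kermx (ratmx A)^T)%MS -> c *m (ratmx M)^T = 0 -> c 0 j != 0 ->
  exists s (f : 'I_s -> 'I_r),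
    [/\ injective f, forall i, f i != j & kernel_basis A (colsub f M)].
Proof.
move=> /eqmxP spanM cM0 cj_neq0; set B := (ratmx M)^T.
pose B' := \matrix_(i, l) (if i == j then 0 else B i l).
have rowB' i : i != j -> row i B' = row i B.
  by move=> /negPf neq_ij; apply/rowP => l; rewrite !mxE neq_ij.
have eqB : (B' :=: B)%MS.
  apply/eqmxP/andP; split; apply/row_subP => i.
    have [->|/rowB'->] := eqVneq i j; last exact: row_sub.
    by rewrite (_ : row j B' = 0) ?sub0mx //; apply/rowP => l; rewrite !mxE eqxx.
  have [->|/rowB'<-] := eqVneq i j; last exact: row_sub.
  rewrite -(scalerK cj_neq0 (row j B)); apply: scalemx_sub.
  move: cM0; rewrite mulmx_sum_row (bigD1 j) //= => /eqP.
  rewrite addr_eq0 => /eqP->; rewrite eqmx_opp; apply: summx_sub => l neq_lj.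
  by rewrite -rowB' // scalemx_sub ?row_sub.
(* A free family contains no zero row. *)
have avoid i : maxrankfun B' i != j.
  apply/eqP => eq_ij; have := maxrowsub_free B'.
  move=> /row_free_inj/(_ (delta_mx (0 : 'I_1) i) 0).
  rewrite mul0mx -rowE row_rowsub eq_ij (_ : row j B' = 0); last first.
    by apply/rowP => l; rewrite !mxE eqxx.
  by move=> /(_ erefl)/rowP/(_ i)/eqP; rewrite !mxE !eqxx oner_eq0.
exists _, (maxrankfun B'); split=> //; first exact: maxrankfun_inj.
have eq_sub : (ratmx (colsub (maxrankfun B') M))^T = rowsub (maxrankfun B') B'.
  by apply/matrixP => i l; rewrite !mxE (negPf (avoid i)).
rewrite /kernel_basis eq_sub maxrowsub_free /=.
by apply/eqmxP; apply: eqmx_trans (eq_maxrowsub _) (eqmx_trans eqB spanM).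
Qed.

Lemma col_degree_colsub (F : fieldType) (n r s : nat) (f : 'I_s -> 'I_r)
    (M : 'M[{poly F}]_(n, r)) (i : 'I_s) :
  col_degree (colsub f M) i = col_degree M (f i).
Proof. by congr _.-1; apply: eq_bigr => l _; rewrite mxE. Qed.

(* A dependent spanning family involving a nonconstant column still spans
   without that column, so its degree sum is not minimal. *)
Lemma minimal_basis_of_spanning (F : fieldType) (m n r : nat)
    (A : 'M[{poly F}]_(m, n)) (M : 'M[{poly F}]_(n, r)) :
  ((ratmx M)^T == kermx (ratmx A)^T)%MS ->
  (forall c : 'rV[{fraction {poly F}}]_r, c *m (ratmx M)^T = 0 ->
     (forall j, c 0 j != 0 -> col_degree M j = 0%N) -> c = 0) ->
  (forall s (Q : 'M[{poly F}]_(n, s)), kernel_basis A Q ->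
     \sum_j col_degree M j <= \sum_j col_degree Q j)%N ->
  minimal_basis A M.
Proof.
move=> spanM free_const leM; split=> //; rewrite /kernel_basis spanM andbT.
apply/inj_row_free => c cM0; apply: free_const => // j cj_neq0.
have [s [f [f_inj f_neqj basis_f]]] := kernel_basis_of_spanning spanM cM0 cj_neq0.
(* Since f is injective and avoids j, the extracted basis has degree sum at most that of the columns
   other than j. As the full sum is no larger, column j has degree 0. *)
apply/eqP; rewrite -leqn0 -(leq_add2r (\sum_(l | l != j) col_degree M l)).
have <- : (\sum_l col_degree M l
    = col_degree M j + \sum_(l | l != j) col_degree M l)%N by rewrite (bigD1 j).
rewrite add0n (leq_trans (leM _ _ basis_f)) //.
under eq_bigr do rewrite col_degree_colsub.
have -> : (\sum_i col_degree M (f i) = \sum_(l in f @: setT) col_degree M l)%N.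
  rewrite big_imset /=; last exact: in2W.
  by apply: eq_bigl => i; rewrite inE.
rewrite big_mkcond [leqRHS]big_mkcond leq_sum // => l _.
by case: imsetP => // -[i _ ->]; rewrite f_neqj.
Qed.

(** * The image of ker L under W, and the theorem *)

(** By [DL_row_kron], W maps ker L into ker P. Conversely x in ker P is the image of V(z) (x) x / v,
    which lies in ker L by [DL_col_kron]. *)
Lemma kernel_image_spans (F : fieldType) (m n k r : nat) (P : 'M[{poly F}]_(m, n))
    (omega : 'cV[F]_k) (L : 'M[{poly F}]_(k * m, k * n))
    (N : 'M[{poly F}]_(k * n, r)) :
  ansatz omega != 0 -> is_DL P (ansatz omega) L -> kernel_basis L N ->
  ((ratmx (map_mx polyC (row_kron omega^T n) *m N))^T == kermx (ratmx P)^T)%MS.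
Proof.
move=> v_neq0 DL /andP[_ /eqmxP spanN].
have LN : L *m N = 0.
  apply/ratmx_inj/trmx_inj; rewrite ratmxM ratmx0 trmx_mul trmx0.
  by apply/sub_kermxP; rewrite spanN.
have PWN : P *m (map_mx polyC (row_kron omega^T n) *m N) = 0.
  rewrite map_row_kron -map_trmx mulmxA -(DL_row_kron DL) -mulmxA LN.
  exact: mulmx0.
apply/andP; split.
  by apply/sub_kermxP; rewrite -trmx_mul -ratmxM PWN ratmx0 trmx0.
set X := kermx (ratmx P)^T.
pose V := ratmx (col_kron (powers_vec k ('X : {poly F})) n).
pose Y := (tofrac (ansatz omega))^-1 *: (X *m V^T).
have /submxP[C eqC] : (Y <= (ratmx N)^T)%MS.
  rewrite spanN; apply/sub_kermxP; rewrite -scalemxAl -mulmxA -trmx_mul -ratmxM.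
  rewrite (DL_col_kron DL) ratmxM trmx_mul mulmxA mulmx_ker mul0mx.
  exact: scaler0.
have <- : Y *m (ratmx (map_mx polyC (row_kron omega^T n)))^T = X.
  rewrite -scalemxAl -mulmxA -trmx_mul -ratmxM map_row_kron -map_trmx.
  rewrite mul_row_col_kron -/(ansatz omega) -scalemx1 ratmxZ.
  rewrite [ratmx 1%:M]map_mx1 linearZ /= trmx1 -scalemxAr mulmx1 scalerA.
  by rewrite mulVf ?scale1r // tofrac_eq0.
by rewrite eqC ratmxM trmx_mul -mulmxA submxMl.
Qed.

Theorem theorem6p3 (F : closedFieldType) (charF0 : [pchar F] =i pred0)
    (m n k : nat) (k_ge2 : (2 <= k)%N)
    (P : 'M[{poly F}]_(m, n)) (gradeP : has_grade k P)
    (omega : 'cV[F]_k) (v_neq0 : ansatz omega != 0)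
    (L : 'M[{poly F}]_(k * m, k * n)) (defL : is_DL P (ansatz omega) L)
    (disjoint_spectra : forall l : option F,
       ~~ (eigenvalue_of_grade k P l && root_of_grade k.-1 (ansatz omega) l))
    (d c : nat) (N : 'M[{poly F}]_(k * n, d + c)) (minN : minimal_basis L N)
    (s : 'S_(d + c)) (Md : 'M[{poly F}]_(n, d)) (Mc : 'M[F]_(n, c))
    (Mhat_partition :
       col_perm s (row_kron (map_mx polyC omega)^T n *m N)
       = row_mx Md (map_mx polyC Mc))
    (Md_nonconstant : no_constant_column Md) :
  [/\ Mc = 0 -> minimal_basis P Md,
      Mc <> 0 -> forall (b : nat) (Mb : 'M[F]_(n, b)),
        column_span_basis Mc Mb ->
        minimal_basis P (row_mx Md (map_mx polyC Mb))
    & minimal_basis P Md <-> Mc = 0].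
Proof.
move=> {charF0 k_ge2 gradeP disjoint_spectra}.
pose W := map_mx polyC (row_kron omega^T n).
have {Mhat_partition}: col_perm s (W *m N) = row_mx Md (map_mx polyC Mc).
  by rewrite /W map_row_kron -map_trmx.
set Mh := row_mx _ _ => eqMh.
have [basisN minN_le] := minN.
(* After transposition, permuting columns is left multiplication by an invertible matrix, which
   preserves the row space. *)
have permT : (ratmx Mh)^T = perm_mx s *m (ratmx (W *m N))^T.
  rewrite -row_permE -eqMh; apply/matrixP => i j; by rewrite !mxE.
have /eqmxP spanW := kernel_image_spans v_neq0 defL basisN.
have spanMh : ((ratmx Mh)^T :=: kermx (ratmx P)^T)%MS.
  rewrite permT; apply: eqmx_trans spanW; apply: eqmxMfull.
  by rewrite row_full_unit unitmx_perm.
have {spanMh}: ((ratmx Md)^T + (ratmx (map_mx polyC Mc))^T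
    :=: kermx (ratmx P)^T)%MS.
  apply: eqmx_trans (addsmxE _ _) _.
  by rewrite -tr_row_mx -ratmx_row.
rewrite ratmx_const map_trmx => spanMh.
(* The columns of [Md] are among those of W N up to order, and the constant matrix W does not raise
   degrees. *)
have degMd : (\sum_j col_degree Md j <= \sum_j col_degree N j)%N.
  apply: (@leq_trans (\sum_j col_degree Mh j)).
    rewrite big_split_ord /= -[leqLHS]addn0 leq_add // leq_sum // => j _.
    by rewrite col_degree_row_mxEl.
  rewrite [leqRHS](reindex_inj (h := s) perm_inj) leq_sum // => j _.
  apply: leq_trans (col_degree_const_mul (row_kron omega^T n) N (s j)).
  rewrite -eqMh leq_col_degree // => i; rewrite mxE.
  exact: (leq_bigmax (F := fun i => size ((W *m N) i (s j)))).
(* Q gives a basis of ker L of no larger degree sum, against which N is minimal. *)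
have minMd r (Q : 'M[{poly F}]_(n, r)) : kernel_basis P Q ->
    (\sum_j col_degree Md j <= \sum_j col_degree Q j)%N.
  move=> /(kernel_basis_lift v_neq0 defL)[t [N' [basisN' leN'Q]]].
  exact: leq_trans degMd (leq_trans (minN_le _ _ basisN') leN'Q).
(* Consequently a dependency supported on columns of degree 0 has zero coefficients on [Md]. *)
have degMd_neq0 j : col_degree Md j != 0%N.
  have [i size_ij] := Md_nonconstant j; rewrite -lt0n /col_degree -subn1 subn_gt0.
  exact: leq_trans size_ij (leq_bigmax (F := fun i => size (Md i j)) i).
have case0 : Mc = 0 -> minimal_basis P Md.
  move=> Mc0; apply: minimal_basis_of_spanning => // [|a _ a_const].
    move: spanMh; rewrite Mc0 trmx0 map_mx0 => spanMd.
    by apply/eqmxP; apply: eqmx_trans spanMd; apply/eqmx_sym/addsmx0.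
  apply/rowP => j; rewrite mxE; apply/eqP; apply/negPn/negP => /a_const.
  exact/eqP.
have basis_case b (Mb : 'M[F]_(n, b)) : column_span_basis Mc Mb ->
    minimal_basis P (row_mx Md (map_mx polyC Mb)).
  move=> /andP[freeMb /eqmxP spanMb].
  (* Equality of spans over F persists over F(z), as does the freeness of [Mb] used below. *)
  have eqMbc : (map_mx (@tofrac {poly F} \o polyC) Mb^T
      :=: map_mx (@tofrac {poly F} \o polyC) Mc^T)%MS.
    by apply/eqmxP; rewrite !map_submx !spanMb submx_refl.
  apply: minimal_basis_of_spanning => [|a|r Q basisQ].
  - rewrite ratmx_row tr_row_mx ratmx_const map_trmx; apply/eqmxP.
    apply: eqmx_trans spanMh; apply: eqmx_trans (eqmx_sym (addsmxE _ _)) _.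
    exact: adds_eqmx.
  - rewrite ratmx_row tr_row_mx ratmx_const map_trmx -[a]hsubmxK mul_row_col.
    move=> eq0 a_const; have a1_0 : lsubmx a = 0.
      apply/rowP => j; rewrite [RHS]mxE; apply/eqP/negPn/negP => aj_neq0.
      have := a_const (lshift b j).
      rewrite row_mxEl col_degree_row_mxEl => /(_ aj_neq0).
      exact/eqP.
    move: eq0; rewrite a1_0 mul0mx add0r => eq0.
    rewrite (_ : rsubmx a = 0) ?row_mx0 //.
    move: freeMb; rewrite -(row_free_map (@tofrac {poly F} \o polyC)).
    by move=> /row_free_inj; apply; rewrite mul0mx.
  - rewrite big_split_ord /= [X in (_ + X)%N]big1 ?addn0 => [|j _].
      by under eq_bigr do rewrite col_degree_row_mxEl; apply: minMd.
    by rewrite col_degree_row_mxEr col_degree_const.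
split=> //; split=> // -[/andP[freeMd /eqmxP spanMd] _].
(* Converse: with a basis [Mb] of the span of [Mc], both [Md] and [Md Mb] are bases of ker P.
   Counting columns gives d = d + rank Mc, hence Mc = 0. *)
pose Mb := (row_base Mc^T)^T.
have [|/andP[free_db /eqmxP span_db] _] := basis_case _ Mb.
  by rewrite /column_span_basis trmxK row_base_free; apply/eqmxP/eq_row_base.
have rankP : \rank (kermx (ratmx P)^T) = d by rewrite -spanMd; apply/eqP.
have := free_db; rewrite /row_free span_db rankP -[X in X == _]addn0 eqn_add2l.
by rewrite eq_sym mxrank_eq0 => /eqP Mc0; apply: trmx_inj; rewrite Mc0 trmx0.
Qed.
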